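(* Let $n\ge 2$ and let $P_n$ be the path on $n$ vertices. For an integer $k$ with $1 \le k \le n/2$, let $M(n,k)$ denote the smallest diameter of a graph obtained from $P_n$ by adding $k$ matching edges. Then $$M(n,k) \;\le\; \frac{n}{k+1} + 4\log_2(k+1) + 1 .$$
   Context: All graphs are simple, undirected and unweighted; the distance between two vertices is the number of edges on a shortest path, and the diameter is the maximum distance over all pairs of vertices. ''Adding $k$ matching edges'' to a graph means adding $k$ new edges (pairs of vertices not already adjacent) such that every vertex is incident to at most one of the new edges, i.e., the new edges form a matching. *)

(* Defs.v *)
From mathcomp Require Import all_boot all_order all_algebra.
From mathcomp Require Import reals exp.

Set Implicit Arguments.
Unset Strict Implicit.
Unset Printing Implicit Defensive.

Import Order.TTheory GRing.Theory Num.Theory.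

(** A simple graph on a [finType] is a symmetric irreflexive adjacency relation. *)

Section Graphs.
Variable T : finType.
Implicit Types (e : rel T) (F : {set {set T}}).

(** [p] lists the vertices after [x], so [m] is the number of edges. *)
Definition has_path e (x y : T) (m : nat) : bool :=
  [exists p : m.-tuple T, [&& path e x p, last x p == y & uniq (x :: p)]].

(** A path has fewer than [#|T|] edges, so the bound on [m] loses nothing; the
    value is [#|T|] when [x] and [y] are not connected. *)
Definition dist e (x y : T) : nat :=
  \big[minn/#|T|]_(m < #|T| | has_path e x y m) m.

Definition diameter e : nat := \max_(x : T) \max_(y : T) dist e x y.

(** Edges to be added are represented as two-element sets of vertices. *)
Definition is_non_edge e (f : {set T}) : bool :=
  [exists x, exists y, [&& x != y, ~~ e x y & f == [set x; y]]].

Definition is_matching F : bool := [forall v, #|[set f in F | v \in f]| <= 1].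

Definition matching_edges e (k : nat) F : bool :=
  [&& #|F| == k, [forall f in F, is_non_edge e f] & is_matching F].

Definition add_edges e F : rel T := [rel x y | e x y || ([set x; y] \in F)].

End Graphs.

Definition path_graph (n : nat) : rel 'I_n :=
  [rel i j : 'I_n | (i.+1 == j :> nat) || (j.+1 == i :> nat)].

(** The default value [n] is not attained when some admissible [F] exists, since
    a connected graph on [n > 0] vertices has diameter at most [n - 1]. For
    [1 <= k] and [2 * k <= n], no admissible [F] exists only for [n = 2],
    [k = 1], where [M n k] is thus [2]. *)
Definition M (n k : nat) : nat :=
  \big[minn/n]_(F : {set {set 'I_n}} | matching_edges (@path_graph n) k F)
    diameter (add_edges (@path_graph n) F).

Definition log2 (R : realType) (x : R) : R := (ln x / ln 2%:R)%R.

(* Main.v *)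
(** Write [m := k + 1]. Choose [m] centers along the path and let them be the
    nodes of a binary heap, the parent of [j] being [j./2]. Each of the [m - 1]
    heap edges is realised by a new edge from the center of the child to a port
    of the parent, a vertex at distance at most 1 from the center of the parent.
    Climbing one heap level thus costs at most 2, so two centers are at distance
    at most [4 * log2 m]. If every vertex is within [r] of a center, the
    diameter is at most [2 * r + 4 * log2 m], and [r] can be taken with
    [2 * r <= n / m + 1]. Inner nodes need room for two ports, but the [2 * k]
    ends of the new edges may exhaust the path, so leaves must be allowed to
    occupy a single vertex; heap order puts the leaves at the end of the path. *)

Require Import Defs.
From mathcomp Require Import all_boot all_order all_algebra.
From mathcomp Require Import reals exp.
From mathcomp Require Import zify lra.
Import Order.TTheory GRing.Theory Num.Theory.

Lemma bigmin_le_cond (I : finType) (P : pred I) (F : I -> nat) b i :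
  P i -> \big[minn/b]_(j | P j) F j <= F i.
Proof.
move=> Pi; have := mem_index_enum i.
elim: (index_enum I) => // j s IHs.
rewrite inE big_cons => /orP[/eqP <-|/IHs le_i].
  by rewrite Pi geq_minl.
by case: ifP => // _; rewrite geq_min le_i orbT.
Qed.

Lemma bigmin_le_default (I : finType) (P : pred I) (F : I -> nat) (b : nat) :
  \big[minn/b]_(j | P j) F j <= b.
Proof. by elim/big_rec: _ => // i x _ le_x; rewrite geq_min le_x orbT. Qed.

(** * Walks of bounded length *)

Section Walks.
Variables (T : finType) (e : rel T).

Definition walk_le (x y : T) (d : nat) : Prop :=
  exists p, [/\ path e x p, last x p = y & size p <= d].

Lemma walk_le_refl x : walk_le x x 0.
Proof. by exists [::]. Qed.

Lemma walk_le_edge x y : e x y -> walk_le x y 1.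
Proof. by move=> exy; exists [:: y]; rewrite /= exy. Qed.

Lemma walk_leW x y d d' : d <= d' -> walk_le x y d -> walk_le x y d'.
Proof.
by move=> le_d [p [px py sp]]; exists p; split=> //; apply: leq_trans le_d.
Qed.

Lemma walk_le_trans y x z d d' :
  walk_le x y d -> walk_le y z d' -> walk_le x z (d + d').
Proof.
move=> [p [px py sp]] [q [qy qz sq]]; exists (p ++ q).
by rewrite cat_path px py qy last_cat py qz size_cat leq_add.
Qed.

Lemma walk_le_sym x y d : symmetric e -> walk_le x y d -> walk_le y x d.
Proof.
move=> e_sym [p [px <- sp]]; exists (rev (belast x p)); split.
- by rewrite rev_path (eq_path (e' := e)).
- by case: p {px sp} => //= z p; rewrite rev_cons last_rcons.
- by rewrite size_rev size_belast.
Qed.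

Lemma dist_le_walk x y d : walk_le x y d -> dist e x y <= d.
Proof.
(* [dist] only sees simple paths, so repeated vertices are cut out first. *)
move=> [p [px py sp]]; case/shortenP: px py => q xq uq le_qp qy.
have le_qd : size q <= d.
  by move: uq => /= /andP[_ uq]; apply: leq_trans sp; apply: uniq_leq_size.
have lt_q : size q < #|T| by have /card_uniqP/=<- := uq; apply: max_card.
have hp : has_path e x y (Ordinal lt_q).
  by apply/existsP; exists (in_tuple q); rewrite xq qy eqxx.
apply: leq_trans le_qd.
exact: (bigmin_le_cond _ (fun m : 'I_#|T| => has_path e x y m) val _ _ hp).
Qed.

Lemma diameter_le d : (forall x y, walk_le x y d) -> diameter e <= d.
Proof. by move=> H; do 2!apply/bigmax_leqP=> ? _; apply/dist_le_walk. Qed.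

End Walks.

Lemma matching_edges_imset (T : finType) (e : rel T) k (p c : 'I_k -> T) :
    injective p -> injective c -> (forall i j, p i != c j) ->
    (forall i, ~~ e (p i) (c i)) ->
  matching_edges e k [set [set p i; c i] | i : 'I_k].
Proof.
move=> p_inj c_inj p_neq_c nadj; apply/and3P; split.
- rewrite card_imset ?card_ord // => i j /setP/(_ (p i)).
  by rewrite !inE eqxx (negPf (p_neq_c i j)) orbF => /esym/eqP; apply: p_inj.
- apply/forall_inP => _ /imsetP[i _ ->]; apply/existsP; exists (p i).
  by apply/existsP; exists (c i); rewrite p_neq_c nadj eqxx.
- apply/forallP => v; apply/card_le1_eqP => f g.
  rewrite !inE => /andP[/imsetP[i _ ->] +] /andP[/imsetP[j _ ->] +].
  rewrite !inE => /orP[]/eqP-> /orP[] => [/eqP/p_inj->|||/eqP/c_inj->] //.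
    by rewrite (negPf (p_neq_c _ _)).
  by rewrite eq_sym (negPf (p_neq_c _ _)).
Qed.

Section PathWithEdges.
Variables (n : nat) (F : {set {set 'I_n}}).
Let e := add_edges (@path_graph n) F.

Lemma add_edges_path_sym : symmetric e.
Proof.
by move=> x y; rewrite /e /add_edges /path_graph /= setUC (orbC (_ == _)).
Qed.

Lemma walk_le_path (x y : 'I_n) d :
  x <= y + d -> y <= x + d -> walk_le _ e x y d.
Proof.
wlog le_xy : x y / x <= y => [wlog_xy xd yd|].
  case: (leqP x y) => [/wlog_xy|/ltnW/wlog_xy] H; first exact: H.
  by apply: walk_le_sym (H _ _) => //; apply: add_edges_path_sym.
elim: d y le_xy => [|d IHd] y le_xy xd yd.
  have -> : y = x by apply: val_inj => /=; lia.
  exact: walk_le_refl.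
case: (leqP y (x + d)) => [yd'|lt_d].
  by apply: (walk_leW _ _ _ _ d) => //; apply: IHd => //; lia.
have lt_y : y.-1 < n by have := ltn_ord y; lia.
rewrite -addn1; apply: (walk_le_trans _ _ (Ordinal lt_y)).
  by apply: IHd => /=; lia.
apply: walk_le_edge; rewrite /e /add_edges /path_graph /=.
by apply/orP; left; apply/orP; left; apply/eqP => /=; lia.
Qed.

End PathWithEdges.

(** * Placement of centers and ports *)

Section Centers.
Variables N m r a : nat.
Hypotheses (r_gt0 : 0 < r) (m_gt1 : 1 < m) (le_ar : a <= r) (lt_aN : a < N).
(** The path has [N + m] vertices. [inner_fit] keeps the centers of nodes with a child
    ([2 * j <= m]) spread out; [cover_fit] lets the [m] spread balls reach the right end. *)
Hypothesis inner_fit : a + r * (m - 2) <= N.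
Hypothesis cover_fit : N + m <= a + (m - 1) * (2 * r + 1) + r + 1.

(** Nodes are numbered from 1. The first argument of [minn] spreads the balls of
    radius [r] from the left end; the second one packs the remaining centers
    against the right end, and is the smaller one only at leaves. *)
Definition center (j : nat) : nat :=
  minn (a + j.-1 * (2 * r + 1)) (N + j.-1).

(** The end, near the center of [j./2], of the edge above the node [j]. The
    root has no edge above it, so its own center serves as the port of node 2
    and only one vertex next to it is used. *)
Definition port (j : nat) : nat :=
  center j./2 + odd j - (~~ odd j && (3 < j)).

Lemma center1 : center 1 = a.
Proof. rewrite /center; lia. Qed.

Lemma center_lt_succ j : 0 < j -> center j < center j.+1.
Proof. rewrite /center; case: j => //= j _; nia. Qed.

Lemma center_le i j : 0 < i -> i <= j -> center i + (j - i) <= center j.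
Proof.
move=> i_gt0; elim: j => [|j IHj]; first by lia.
rewrite leq_eqVlt => /orP[/eqP<-|lt_ij]; first by lia.
by have := center_lt_succ j; have := IHj; lia.
Qed.

Lemma center_lt_size j : 0 < j <= m -> center j < N + m.
Proof. rewrite /center; lia. Qed.

Lemma center_step j : 0 < j -> center j.+1 <= center j + (2 * r + 1).
Proof. rewrite /center; case: j => //= j _; nia. Qed.

Lemma center_inner j : 0 < j -> 2 * j <= m -> center j = a + j.-1 * (2 * r + 1).
Proof.
case: j => // j _ jm; rewrite /center /=; apply/minn_idPl.
have : r * (2 * j) <= r * (m - 2) by rewrite leq_mul2l; lia.
lia.
Qed.

(** A gap of 3 separates the right port of [j] from the left port of [j.+1]. *)
Lemma center_inner_step j :
  0 < j -> 2 * j.+1 <= m -> center j + 3 <= center j.+1.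
Proof. by case: j => // j _ jm; rewrite !center_inner //=; nia. Qed.

(** Node [j] has two children, but [j.+1] may be a packed leaf; its center must still avoid the
    right port of [j]. *)
Lemma center_inner_step2 j :
  0 < j -> 2 * j < m -> center j + 2 <= center j.+1.
Proof.
case: j => // j _ jm; rewrite center_inner //=; last by lia.
have : r * (2 * j).+1 <= r * (m - 2) by rewrite leq_mul2l; lia.
rewrite /center /=; nia.
Qed.

(** A new edge joins these two centers, so they must not be adjacent. If center 2 is packed at
    [N + 1], this is [lt_aN]. *)
Lemma center2 : center 1 + 2 <= center 2.
Proof. rewrite /center /=; nia. Qed.

Lemma center_cover v : v < N + m -> exists2 j, 0 < j <= m &
  (v <= center j + r) && (center j <= v + r).
Proof.
move=> lt_v; have : v <= center m + r by rewrite /center; nia.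
have : 0 < m by lia.
(* Descend to the first ball whose right end reaches [v]; the previous ball stops before [v], so a
   step of at most [2 * r + 1] leaves no hole. *)
elim: {1 3 4}m (leqnn m) => // j IHj lt_jm _ le_v.
case: (posnP j) => [j0|j_gt0].
  exists 1; first by lia.
  by move: le_v; rewrite j0 center1; lia.
case: (leqP v (center j + r)) => [|lt_cv]; first by apply: IHj => //; lia.
exists j.+1; first by lia.
by have := center_step j j_gt0; lia.
Qed.

Lemma port_near j :
  1 < j -> port j <= center j./2 + 1 /\ center j./2 <= port j + 1.
Proof. by rewrite /port; case: odd; lia. Qed.

Lemma port_lt_succ j : 1 < j < m -> port j < port j.+1.
Proof.
move=> /andP[j_gt1 jm]; rewrite /port /= uphalfE.
have [o|o] := boolP (odd j).
  have -> : j.+1./2 = j./2.+1 by lia.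
  have := center_inner_step j./2; lia.
have -> : j.+1./2 = j./2 by lia.
by have := center_lt_succ 1; have := center2; rewrite /=; lia.
Qed.

Lemma port_neq_center i j : 1 < i <= m -> 1 < j <= m -> port i <> center j.
Proof.
move=> /andP[i_gt1 im] /andP[j_gt1 jm].
have := port_near i i_gt1; rewrite /port.
have [j_lt|j_gt|j_eq] := ltngtP j i./2.
- have := center_le j i./2.-1; have := center_inner_step i./2.-1.
  have -> : i./2.-1.+1 = i./2 by lia.
  lia.
- have := center_le i./2.+1 j; have := center_lt_succ i./2.
  case: (boolP (odd i)) => o; last by lia.
  have := center_inner_step2 i./2; lia.
(* Here [center j] is positive, so the truncated subtraction in [port] does leave the center. *)
- have := center_le 1 j; rewrite -j_eq; case: (odd i) => /=; lia.
Qed.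

(** Ensures that the new edges are not path edges and that ports lie on the path. *)
Lemma port_center_gap j : 1 < j <= m -> port j + 2 <= center j.
Proof.
move=> /andP[j_gt1 jm]; rewrite /port.
have := center2; have := center_le 2 j.
have [j_gt3|] := ltnP 3 j; last first.
  by move: j_gt1 jm; case: j => [|[|[|[|j]]]] //=; lia.
have := center_le j./2 j; have := center_inner_step2 j./2.
have := center_le j./2.+1 j; case: (odd j) (odd_double_half j) => /= ; lia.
Qed.

Lemma port_inj i j : 1 < i <= m -> 1 < j <= m -> port i = port j -> i = j.
Proof.
have lt_port u v : 1 < u -> u < v -> v <= m -> port u < port v.
  move=> u_gt1; elim: v => // v IHv.
  rewrite ltnS leq_eqVlt => /orP[/eqP<-|lt_uv] vm.
    by apply: port_lt_succ; lia.
  by apply: ltn_trans (port_lt_succ v _); [apply: IHv; lia | lia].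
by move=> ? ?; have := lt_port i j; have := lt_port j i; lia.
Qed.

Lemma M_le_centers : M (N + m) m.-1 <= 2 * r + 4 * trunc_log 2 m.
Proof.
have n_gt0 : 0 < N + m by lia.
pose vtx i : 'I_(N + m) := insubd (Ordinal n_gt0) i.
have vtxE i : i < N + m -> vtx i = i :> nat by move=> ?; rewrite val_insubd ifT.
pose c j := vtx (center j); pose p j := vtx (port j).
have cE j : 0 < j <= m -> c j = center j :> nat.
  by move=> ?; apply: vtxE; apply: center_lt_size.
have pE j : 1 < j <= m -> p j = port j :> nat.
  move=> jm; apply: vtxE.
  by have := port_center_gap j jm; have := center_lt_size j; lia.
(* Index [i] stands for node [i.+2]: every node but the root has an edge above it. *)
have idx (i : 'I_m.-1) : 1 < i.+2 <= m by have := ltn_ord i; lia.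
have adm : matching_edges (@path_graph (N + m)) m.-1
    [set [set p i.+2; c i.+2] | i : 'I_m.-1].
  apply: matching_edges_imset.
  - move=> i j /(congr1 val) /=; rewrite !pE ?idx // => /port_inj.
    by move=> /(_ (idx _) (idx _)) [] /val_inj.
  - move=> i j /(congr1 val) /=; rewrite !cE; [|exact: idx..].
    move=> eq_c; apply: val_inj => /=; have := center_le i.+2 j.+2.
    by have := center_le j.+2 i.+2; lia.
  - move=> i j; apply/eqP => /(congr1 val) /=.
    rewrite pE ?idx // cE; last exact: idx.
    by apply: port_neq_center.
  - move=> i; rewrite /path_graph /= pE ?idx // cE; last exact: idx.
    by have := port_center_gap _ (idx i); lia.
apply: leq_trans (bigmin_le_cond _ _ _ _ _ adm) _.
set F := [set _ | _ : _]; set e := add_edges _ _.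
have e_sym : symmetric e by apply: add_edges_path_sym.
have edge j : 1 < j <= m -> walk_le _ e (c j) (p j) 1.
  move=> jm; apply: walk_le_edge; rewrite /e /add_edges /=; apply/orP; right.
  have lt_j : j.-2 < m.-1 by lia.
  apply/imsetP; exists (Ordinal lt_j) => //=.
  have -> : j.-2.+2 = j by lia.
  by rewrite setUC.
have to_root j : 0 < j <= m -> walk_le _ e (c j) (c 1) (2 * trunc_log 2 j).
  elim/ltn_ind: j => j IHj jm.
  have [j1|j_gt1] := leqP j 1.
    have -> : j = 1 by lia.
    by apply: walk_leW (walk_le_refl _ _ _).
  rewrite trunc_log2S // mulnS; apply: (walk_le_trans _ _ (c j./2)).
    2: by apply: IHj; lia.
  apply: (walk_le_trans _ _ (p j) _ _ 1 1); first by apply: edge; lia.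
  have := port_near j j_gt1 => near_j.
  by apply: walk_le_path; rewrite pE ?cE; lia.
have from_any (v : 'I_(N + m)) : walk_le _ e v (c 1) (r + 2 * trunc_log 2 m).
  have [j jm cov] := center_cover v (ltn_ord v).
  apply: (walk_le_trans _ _ (c j)); last first.
    apply: walk_leW (to_root j jm); rewrite leq_mul2l /=.
    by apply: leq_trunc_log; lia.
  by apply: walk_le_path; rewrite cE //; lia.
apply: diameter_le => x y.
have from_root := walk_le_sym _ _ _ _ _ e_sym (from_any y).
apply: walk_leW (walk_le_trans _ _ _ _ _ _ _ (from_any x) from_root).
lia.
Qed.

End Centers.

(** * Choice of the radius and the real bound *)

Lemma M_le (n k : nat) : 3 < n -> 0 < k -> 2 * k <= n ->
  exists2 r, 2 * r * k.+1 <= n + k.+1 & M n k <= 2 * r + 4 * trunc_log 2 k.+1.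
Proof.
move=> n_gt3 k_gt0 le_kn; pose r := (n + k.+1) %/ (2 * k.+1).
have r_le : 2 * r * k.+1 <= n + k.+1.
  by rewrite mulnAC mulnC; apply: leq_trunc_div.
have r_gt0 : 0 < r by rewrite divn_gt0; lia.
have r_lt : n + k.+1 < r.+1 * (2 * k.+1) by rewrite ltn_ceil.
exists r => //; have nE : n = (n - k.+1) + k.+1 by lia.
have r_le' : 2 * r.-1 * k.+1 <= n - k.+1 by nia.
(* For [inner_fit]: if [r] is at least 2, then [r * k <= 2 * r.-1 * k.+1 <= n - k.+1]; if [r = 1],
   it follows from [2 * k <= n] and the choice of [a]. *)
have r_cases : r = 1 \/ r <= 2 * r.-1 by lia.
(* For [n = 2 * k] no vertex is left over before the center of the root. *)
pose a := if n == 2 * k then 0 else r.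
rewrite [in X in X <= _]nE; apply: (M_le_centers _ _ r a) => //.
- by rewrite /a; case: ifP.
- by rewrite /a; case: eqP => ?; nia.
- by rewrite /a; case: eqP => ?; nia.
- by rewrite /a; case: eqP => ?; nia.
Qed.

Local Open Scope ring_scope.

Lemma trunc_log2_le_log2 (R : realType) (m : nat) :
  (0 < m)%N -> (trunc_log 2 m)%:R <= log2 (m%:R : R).
Proof.
move=> m_gt0; have ln2_gt0 : 0 < ln 2%:R :> R by rewrite ln_gt0 // ltr1n.
rewrite /log2 ler_pdivlMr // mulr_natl -lnXn ?ltr0n // -natrX.
by rewrite ler_ln ?posrE ?ltr0n ?expn_gt0 // ler_nat trunc_logP.
Qed.

Theorem theorem2 (R : realType) (n k : nat)
    (hn : (2 <= n)%N) (hk1 : (1 <= k)%N) (hk2 : (2 * k <= n)%N) :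
  ((M n k)%:R <= n%:R / (k + 1)%:R + 4%:R * log2 (k + 1)%:R + 1 :> R)%R.
Proof.
have log2_ge := trunc_log2_le_log2 R (k + 1) ltac:(lia).
have k1_gt0 : 0 < (k + 1)%:R :> R by rewrite ltr0n addn1.
(* For [n <= 3] the default value of [M] suffices, since the logarithmic term is at least 4. *)
have [n_le3|n_gt3] := leqP n 3.
  have M_le3 : (M n k)%:R <= 3%:R :> R.
    by rewrite ler_nat; apply: leq_trans n_le3; apply: bigmin_le_default.
  have log_ge1 : 1 <= (trunc_log 2 (k + 1))%:R :> R.
    by rewrite ler1n trunc_log_gt0; lia.
  have := divr_ge0 (ler0n R n) (ltW k1_gt0); lra.
have [r r_le M_ler] := M_le n k n_gt3 hk1 hk2.
rewrite -[k.+1]addn1 in r_le M_ler.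
have r_leR : (2 * r)%:R <= n%:R / (k + 1)%:R + 1 :> R.
  rewrite -(ler_pM2r k1_gt0) mulrDl mul1r divfK ?gt_eqF //.
  by rewrite -natrM -natrD ler_nat.
move: M_ler; rewrite -(ler_nat R) natrD [(4 * _)%:R]natrM; lra.
Qed.
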